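(* Let $X$ be a proper, uniquely geodesic, straight metric space which is $C^1$ along geodesics and has constant distance variation. Then the compactification $(i,\overline{X}^V)$ is isomorphic to the horofunction compactification $(h,\overline{X}^h)$.
   Context: A geodesic in $(X,d)$ is a map $\gamma:I\to X$ from an interval with $d(\gamma(t),\gamma(s))=|t-s|$. $X$ is proper if closed balls are compact; uniquely geodesic if any two distinct points are joined by a unique geodesic; straight if every geodesic segment is contained in a unique bi-infinite geodesic. $X$ is $C^1$ along geodesics if, given a point $p\in X$ and a geodesic segment $\gamma$ that does not pass through $p$, the function $t\mapsto d(\gamma(t),p)$ is differentiable and the value of the derivative depends continuously on both $t$ and $p$. $X$ has constant distance variation if for any two distinct geodesics $\gamma,\eta$ with $\gamma(0)=\eta(0)$ either \[\left.\tfrac{d}{dt}d(\gamma(t),\eta(s))\right|_{t=0}=\left.\tfrac{d}{dt}d(\gamma(t),\eta(1))\right|_{t=0}\] for all $s>0$, or $\left.\frac{d}{dt}d(\gamma(t),\eta(s))\right|_{t=0}$ does not exist for any $s>0$. A compactification of $X$ is a pair $(f,\overline{X})$ with $\overline X$ compact and $f:X\to\overline X$ an embedding with dense image; $(f_1,X_1)$ is finer than $(f_2,X_2)$ if there is a continuous $\overline f_2:X_1\to X_2$ with $\overline f_2\circ f_1=f_2$; two compactifications are isomorphic if each is finer than the other. Visual compactification based at $b$: $D_b$ is the set of geodesic rays $[0,\infty)\to X$ starting at $b$, with uniform convergence on compact sets. The map $(\theta,r)\mapsto\theta(r)$ is a homeomorphism $D_b\times[0,\infty)/(D_b\times\{0\})\to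 X$, and $\overline{X}^v_b=X\cup D_b$ carries the topology of $D_b\times[0,\infty]/(D_b\times\{0\})$, with $D_b\times\{\infty\}$ identified with $D_b$. Let $E=\prod_{b\in X}\overline{X}^v_b$ with the product topology, and let $i:X\hookrightarrow E$ be the diagonal inclusion (each coordinate of $i(x)$ equals $x$). $\overline{X}^V$ is the closure of $i(X)$ in $E$; $(i,\overline{X}^V)$ is a compactification of $X$. Horofunction compactification: for a fixed $b\in X$, $h:X\to C(X)$, $h(x)(\cdot)=d(x,\cdot)-d(x,b)$, with $C(X)$ given the topology of uniform convergence on compact sets; $\overline{X}^h=\overline{h(X)}$. *)

(* Defs.v *)
From HB Require Import structures.
From mathcomp Require Import all_boot all_order all_algebra.
From mathcomp Require Import all_classical all_reals.
From mathcomp Require Import topology ereal normedtype.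

Set Implicit Arguments.
Unset Strict Implicit.
Unset Printing Implicit Defensive.

Import Order.TTheory GRing.Theory Num.Theory.
Import numFieldNormedType.Exports.

Local Open Scope classical_set_scope.
Local Open Scope ring_scope.

(* Intervals are used as subtypes, [set` I] being coerced to the topological
   type of the points of I. *)
Section Geodesics.
Context {R : realType} {X : metricType R}.

Definition geodesic (I : interval R) (g : [set` I] -> X) : Prop :=
  forall s t : [set` I], mdist (g s) (g t) = `|\val s - \val t|.

(* Domain-independent forms of "g is defined at r and g(r) = x" and of
   "g and h coincide wherever both are defined". *)
Definition passes_at (I : interval R) (g : [set` I] -> X) (r : R) (x : X) :=
  exists2 t : [set` I], \val t = r & g t = x.

Definition agree (I J : interval R) (g : [set` I] -> X) (h : [set` J] -> X) :=
  forall (s : [set` I]) (t : [set` J]), \val s = \val t -> g s = h t.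

(* The derivative is one-sided at an endpoint of I, because the limit is taken
   in the subtype of the points of I. *)
Definition has_derivative (I : interval R) (f : [set` I] -> R)
    (t : [set` I]) (l : R) : Prop :=
  (f s - f t) / (\val s - \val t) @[s --> t^'] --> l.

End Geodesics.

Section MetricProperties.
Context {R : realType} (X : metricType R).

Definition proper_space : Prop :=
  forall (x : X) (r : R), compact [set y : X | mdist x y <= r].

Definition uniquely_geodesic : Prop :=
  forall x y : X, x <> y ->
    exists! g : [set` `[0, mdist x y]] -> X,
      [/\ geodesic g, passes_at g 0 x & passes_at g (mdist x y) y].

(* Segments have positive length; the bi-infinite geodesic extends the
   segment as a parametrized curve. *)
Definition straight : Prop :=
  forall (a b : R) (g : [set` `[a, b]] -> X), a < b -> geodesic g ->
    exists! G : [set` `]-oo, +oo[] -> X, geodesic G /\ agree g G.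

(* D (t, p) is the value of the derivative; it is continuous jointly in (t, p),
   where p ranges over the complement of the image of g. *)
Definition C1_along_geodesics : Prop :=
  forall (a b : R) (g : [set` `[a, b]] -> X), a < b -> geodesic g ->
    exists D : [set` `[a, b]] * X -> R,
      (forall t p, ~ range g p ->
         has_derivative (fun s => mdist (g s) p) t (D (t, p))) /\
      {within [set tp | ~ range g tp.2], continuous D}.

(* e is defined at every s >= 0, since the derivatives are compared for all
   s > 0 with the one at s = 1: the common value l is the latter.  Geodesics
   are distinct when they differ as maps, domain included. *)
Definition constant_distance_variation : Prop :=
  forall (I J : interval R) (g : [set` I] -> X) (e : [set` J] -> X)
      (t0 : [set` I]) (s0 : [set` J]),
    geodesic g -> geodesic e -> ~ (I = J /\ agree g e) ->
    \val t0 = 0 -> \val s0 = 0 -> g t0 = e s0 ->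
    {subset `[0, +oo[ <= J} ->
    (exists l : R, forall s : [set` J], 0 < \val s ->
       has_derivative (fun t => mdist (g t) (e s)) t0 l) \/
    (forall s : [set` J], 0 < \val s ->
       ~ exists l : R, has_derivative (fun t => mdist (g t) (e s)) t0 l).

End MetricProperties.

Section Compactifications.
Context {X : topologicalType}.

Definition embedding {Y : topologicalType} (f : X -> Y) : Prop :=
  [/\ continuous f, injective f &
      forall U : set X, open U ->
        exists2 V : set Y, open V & f @` U = V `&` range f].

Definition is_compactification {Y : topologicalType} (f : X -> Y) : Prop :=
  [/\ compact [set: Y], embedding f & dense (range f)].

Definition finer {Y1 Y2 : topologicalType} (f1 : X -> Y1) (f2 : X -> Y2) :=
  exists2 g : Y1 -> Y2, continuous g & g \o f1 = f2.

Definition isomorphic_compactifications {Y1 Y2 : topologicalType}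
    (f1 : X -> Y1) (f2 : X -> Y2) : Prop :=
  [/\ is_compactification f1, is_compactification f2, finer f1 f2
    & finer f2 f1].

End Compactifications.

Definition closure_space {X : Type} {E : topologicalType} (f : X -> E) :
  topologicalType := closure (range f).

Definition to_closure {X : Type} {E : topologicalType} (f : X -> E) (x : X) :
    closure_space f :=
  exist _ (f x) (mem_set (subset_closure (imageP f (I : setT x)))).

Section Visual.
Context {R : realType} {X : metricType R}.

Definition rays (b : X) :=
  [set g : {family compact, [set` `[0 : R, +oo[] -> X} |
     geodesic g /\ passes_at g 0 b].

(* The underlying set of the visual compactification is the disjoint union of
   X and D_b. *)
Definition visual (b : X) : Type := (X + rays b)%type.

HB.instance Definition _ (b : X) := Choice.copy (visual b) (X + rays b)%type.

Lemma finite_nonneg (r : R) : (0 <= r%:E)%E -> r \in `[0, +oo[.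
Proof. by rewrite lee_fin in_itv /= andbT. Qed.

(* The map D_b x [0, +oo] -> X u D_b which sends (g, r) to g(r) when r is
   finite and to g when r = +oo; the branch r = -oo is unreachable. *)
Definition polar (b : X) (gr : rays b * [set r : \bar R | (0 <= r)%E]) :
    visual b :=
  match \val gr.2 as r return (0 <= r)%E -> visual b with
  | r%:E => fun r0 =>
      inl (\val gr.1 (exist _ r (mem_set (finite_nonneg r0))))
  | _ => fun _ => inr gr.1
  end%E (set_mem (valP gr.2)).

(* The quotient topology along polar: when X is straight and uniquely geodesic
   and has at least two points, polar is onto and its only identifications are
   (g, 0) ~ (g', 0). *)
Definition visual_open (b : X) (U : set (visual b)) : Prop :=
  open (@polar b @^-1` U).

Lemma visual_openT (b : X) : @visual_open b setT.
Proof. by rewrite /visual_open preimage_setT; exact: openT. Qed.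

Lemma visual_openI (b : X) : setI_closed (@visual_open b).
Proof. by move=> U V oU oV; exact: openI. Qed.

Lemma visual_open_bigU (b : X) (I : Type) (U : I -> set (visual b)) :
  (forall i, visual_open (U i)) -> visual_open (\bigcup_i U i).
Proof.
move=> oU; rewrite /visual_open preimage_bigcup.
by apply: bigcup_open => i _; exact: oU.
Qed.

HB.instance Definition _ (b : X) := isOpenTopological.Build (visual b)
  (@visual_openT b) (@visual_openI b) (@visual_open_bigU b).

Definition visual_product : topologicalType :=
  prod_topology (fun b : X => visual b : topologicalType).

Definition visual_diagonal (x : X) : visual_product := fun b => inl x.

Definition visual_compactification : topologicalType :=
  closure_space visual_diagonal.

Definition visual_embedding : X -> visual_compactification :=
  to_closure visual_diagonal.

End Visual.

Section Horofunction.
Context {R : realType} {X : metricType R}.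

Definition continuous_functions : topologicalType :=
  [set f : {family compact, X -> R} | continuous (f : X -> R)].

Lemma continuous_mdist (x : X) : continuous (mdist x).
Proof.
move=> y; apply/cvgrPdist_lt => e e0.
have : nbhs y (ball y e) by exact: nbhsx_ballx.
apply: filterS => z; rewrite ballEmdist /= => yz.
apply: le_lt_trans yz; rewrite ler_norml lerBrDr lerBlDr.
rewrite addrC lerBlDr metric_triangle /= addrC (metric_sym y z).
exact: metric_triangle.
Qed.

Lemma horofunction_continuous (b x : X) :
  continuous (fun y => mdist x y - mdist x b).
Proof.
move=> y; apply: cvgB; last exact: cvg_cst.
exact: continuous_mdist.
Qed.

Definition horofunction (b x : X) : continuous_functions :=
  exist _ ((fun y => mdist x y - mdist x b) : {family compact, X -> R})
    (mem_set (@horofunction_continuous b x)).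

Definition horofunction_compactification (b : X) : topologicalType :=
  closure_space (horofunction b).

Definition horofunction_embedding (b : X) :
    X -> horofunction_compactification b :=
  to_closure (horofunction b).

End Horofunction.

Arguments visual_compactification {R} X.
Arguments visual_embedding {R} X.

(* Main.v *)
From HB Require Import structures.
Require Import Defs.
From mathcomp Require Import all_boot all_order all_algebra.
From mathcomp Require Import all_classical all_reals.
From mathcomp Require Import topology ereal normedtype.
From mathcomp Require Import derive realfun lra.

Set Implicit Arguments.
Unset Strict Implicit.
Unset Printing Implicit Defensive.

Import Order.TTheory GRing.Theory Num.Theory.
Import numFieldNormedType.Exports.

Local Open Scope classical_set_scope.
Local Open Scope ring_scope.

(** ** Idea of the proof

    Write H for the horofunction compactification and f for its points, which
    are 1-Lipschitz functions on X.  H is compact and a product of visual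
    compactifications is Hausdorff, so a continuous injection of H into the
    product which restricts to the diagonal on X is a homeomorphism of H onto
    the closure of the diagonal
    ([isomorphic_compactifications_of_bijection]).  The injection sends f to
    the family, indexed by the base point p, of its directions of steepest
    descent at p.

    These directions exist by compactness.  If f is the distance to a point x,
    up to a constant, then the geodesic from p to x lowers f at unit speed down
    to its minimum.  In the limit, every f has from every p a geodesic of some
    length in [0, +oo] along which it decreases at unit speed, and which stops
    only at a minimum of f ([gradient_exists]).  In the same way, prolonging
    the geodesic from x to p beyond p yields for every f a point q at distance
    1 from p with f q = f p + 1 ([ascent_exists]).  Since f is 1-Lipschitz, a
    geodesic from q to p followed by a descending geodesic of positive length
    is still a geodesic, and straightness leaves only one possible
    continuation: the direction of descent is unique ([gradient_unique]).
    Existence and uniqueness, together with the closedness of the relation and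
    the compactness of the set of directions, make it depend continuously on f
    ([continuous_direction]).

    It remains to recover f from its directions.  If the descent from some
    point stops, then f has a minimum, and its location determines f
    ([horo_minimum]).  Otherwise let f and g have the same infinite ray from
    every point.  At a point p both functions have the same q behind p and the
    same w ahead of p, at distance 1, and the Lipschitz bounds from these two
    points leave to f - g, between p and y, a variation of at most
    d(y, q) + d(y, w) - d(q, w) ([horo_difference]).  This excess is
    nonnegative and vanishes at y = p; distances being differentiable along
    lines, its derivative along a line through p vanishes.  So f - g has
    derivative zero everywhere along each line, hence is constant
    ([direction_injective]). *)

(** * General topology *)

Section Topology.

Lemma separated_hausdorff (T : topologicalType) :
  (forall x y : T, x <> y -> exists (S : topologicalType) (f : T -> S),
     [/\ hausdorff_space S, continuous f & f x <> f y]) ->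
  hausdorff_space T.
Proof.
move=> sepT x y xy; apply: contrapT => /sepT [S [f [hS cf]]]; apply; apply: hS.
move=> A B fxA fyB; have [z [Az Bz]] := xy _ _ (cf x A fxA) (cf y B fyB).
by exists (f z).
Qed.

Lemma compact_set_val (T : topologicalType) (A K : set T) :
  K `<=` A -> compact K -> compact (set_val @^-1` K : set A).
Proof.
move=> KA cK F FF FK; have [x [Kx clx]] := cK (set_val @ F) _ FK.
exists (exist _ x (mem_set (KA x Kx))); split => //.
move=> B U FB [_ [[W oW <-]] Wx WU].
have [||y [[z Bz zy] Wz]] := clx (set_val @` B) W.
- have : B `<=` set_val @^-1` (set_val @` B) by move=> z Bz; exists z.
  by move=> /filterS; apply.
- exact: open_nbhs_nbhs.
- by rewrite -zy in Wz; exists z; split => //; exact: WU.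
Qed.

Lemma continuous_into_set_type (S T : topologicalType) (A : set T)
    (f : S -> A) :
  continuous (set_val \o f) -> continuous f.
Proof. exact: (@continuous_comp_initial A S T set_val). Qed.

Lemma continuous_into_product (S : topologicalType) (I : Type)
    (T : I -> topologicalType) (g : S -> prod_topology T) :
  (forall i, continuous (fun s => g s i)) -> continuous g.
Proof.
move=> cg s; apply/cvg_sup => i U [_ [[W oW <-]] Ws /filterS]; apply.
by apply: (cg i s); exact: open_nbhs_nbhs.
Qed.

Lemma compact_set_type (T : topologicalType) (A : set T) :
  compact A -> compact [set: A].
Proof.
move=> cA; have := compact_set_val (@subset_refl _ A) cA.
by congr compact; apply/seteqP; split => // x _; exact: set_valP.
Qed.

(** Projecting along a compact factor preserves closedness.  This is what lets
    existence statements pass to limits. *)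
Lemma closed_projection (Z Y : topologicalType) (K : set Z) (C : set (Z * Y)) :
  compact K -> closed C -> closed [set y | exists2 z, K z & C (z, y)].
Proof.
move=> /compact_near_coveringP cK /closed_openC oC.
rewrite -[X in closed X]setCK; apply: open_closedC; rewrite openE => y nKy.
have := cK Y (nbhs y) (fun y z => ~ C (z, y)) _.
have : forall z, K z -> \forall z' \near z & y' \near y, ~ C (z', y').
  move=> z Kz; have nC : (~` C) (z, y) by move=> Czy; apply: nKy; exists z.
  have [[U V] [/= Uz Vy] UV] := open_nbhs_nbhs (conj oC nC).
  by exists (U, V) => // zy' /UV; case: zy'.
move=> /[swap] /[apply]; apply: filterS => y' ny' [z Kz Cz].
exact: ny' Kz Cz.
Qed.

(** A closed-graph theorem in which the graph is only known upstairs, along a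
    possibly non-injective parametrization p of the target by a compact space:
    the preimage of a closed set is the projection of a closed set. *)
Lemma continuous_of_closed_relation (Z Y V : topologicalType)
    (C : set (Z * Y)) (p : Z -> V) (g : Y -> V) :
  compact [set: Z] -> closed C -> continuous p ->
  (forall y, exists z, C (z, y)) -> (forall z y, C (z, y) -> p z = g y) ->
  continuous g.
Proof.
move=> cZ cC cp Cex Cp; apply/continuous_closedP => D cD.
suff -> : g @^-1` D =
    [set y | exists2 z, setT z & (C `&` (p \o fst) @^-1` D) (z, y)].
  apply: closed_projection => //; apply: closedI => //.
  apply: preimage_closed => // z _.
  by apply: continuous_comp; [exact: cvg_fst | exact: cp].
apply/seteqP; split => [y Dy | y [z _ [Czy]]].
  have [z Czy] := Cex y; exists z => //; split => //.
  by rewrite /preimage /= (Cp _ _ Czy).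
by rewrite /preimage /= (Cp _ _ Czy).
Qed.

(** The image of a closed set is compact, hence closed; in particular the range
    is closed, and being dense it is everything. *)
Lemma compact_injective_dense_inverse (H V : topologicalType) (g : H -> V)
    (D : set H) :
  compact [set: H] -> hausdorff_space V -> continuous g -> injective g ->
  dense (g @` D) -> exists2 k : V -> H, continuous k & cancel g k /\ cancel k g.
Proof.
move=> cH hV cg ig dg.
have closed_img C : closed C -> closed (g @` C).
  move=> cC; apply: compact_closed hV _; apply: continuous_compact.
    exact: continuous_subspaceT.
  exact: subclosed_compact cC cH _.
have sg v : exists x, g x = v.
  apply: contrapT => nv.
  have oC := closed_openC (closed_img _ closedT).
  have [|w [nw [x _ xw]]] := dg _ _ oC; last by apply: nw; exists x.
  by exists v => -[x _ xv]; apply: nv; exists x.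
pose k v := sval (cid (sg v)).
have kK v : g (k v) = v by rewrite /k; case: cid.
have gK : cancel g k by move=> x; apply: ig; rewrite kK.
exists k => //; apply/continuous_closedP => C /closed_img.
congr closed; apply/seteqP; split => [_ [x Cx <-]|v Cv].
  by rewrite /preimage /= gK.
by exists (k v) => //; exact: kK.
Qed.

(** Since g turns out to be a homeomorphism, the compactness of Y1 and the
    embedding property of f1 are inherited from Y2 and f2. *)
Lemma isomorphic_compactifications_of_bijection
    (X Y1 Y2 : topologicalType) (f1 : X -> Y1) (f2 : X -> Y2) (g : Y2 -> Y1) :
  is_compactification f2 -> hausdorff_space Y1 -> dense (range f1) ->
  continuous g -> injective g -> g \o f2 = f1 ->
  isomorphic_compactifications f1 f2.
Proof.
move=> [cY2 [cf2 if2 of2] df2] hY1 df1 cg ig gf.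
have [|k ck [gK kK]] :=
    @compact_injective_dense_inverse _ _ g (range f2) cY2 hY1 cg ig.
  by rewrite image_comp gf.
have kf : k \o f1 = f2 by rewrite -gf; apply/funext => x /=; rewrite gK.
split => //; [|exists k => //|exists g => //].
split => //.
  have -> : [set: Y1] = range g by apply/seteqP; split => // v _; exists (k v).
  by apply: continuous_compact => //; exact: continuous_subspaceT.
rewrite -gf; split.
- by move=> x; apply: continuous_comp; [exact: cf2 | exact: cg].
- exact: inj_comp.
- move=> U /of2[V oV VE]; exists (k @^-1` V).
    by apply: open_comp => // x _; exact: ck.
  apply/seteqP; split => [_ [x Ux <-]|v [Vv [x _ xv]]].
    split; last by exists x.
    have [] : (V `&` range f2) (f2 x) by rewrite -VE; exists x.
    by rewrite /preimage /= gK.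
  have [x' Ux' xx'] : (f2 @` U) (f2 x).
    by rewrite VE; split; [move: Vv; rewrite /preimage /= -xv /= gK | exists x].
  by exists x' => //=; rewrite xx'.
Qed.

Lemma dense_to_closure (X : Type) (E : topologicalType) (f : X -> E) :
  dense (range (to_closure f)).
Proof.
move=> O [x Ox] oO.
case: oO Ox => W oW <- Wx.
have [_ [[y _ <-] Wy]] := set_valP x W (open_nbhs_nbhs (conj oW Wx)).
by exists (to_closure f y); split; last by exists y.
Qed.

End Topology.

(** * Lines in a straight space *)

Section Lines.
Context {R : realType} {X : metricType R}.
Implicit Types (g h G : R -> X) (a b s t : R).

(** Geodesics are handled as total functions that are isometric on an interval,
    so that restricting, shifting and concatenating them changes no type. *)
Definition isometric_on (I : interval R) g :=
  {in I &, forall s t, mdist (g s) (g t) = `|s - t|}.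

Definition line G := forall s t, mdist (G s) (G t) = `|s - t|.

Context (straightX : straight X).

Lemma straight_line a b g : a < b -> isometric_on `[a, b] g ->
  exists2 G, line G & {in `[a, b], G =1 g}.
Proof.
move=> ab gI; pose g' (t : [set` `[a, b]]) := g (\val t).
have [|G [[Gg GE] _]] := straightX (g := g') ab.
  by move=> s t; apply: gI; [exact: (set_valP s)|exact: (set_valP t)].
have inT t : t \in [set` `]-oo, +oo[%R] by rewrite inE /= in_itv.
exists (fun t => G (exist _ t (inT t))) => [s t|t tab].
  exact: Gg.
by rewrite -(GE (exist _ t (mem_set tab))).
Qed.

Lemma line_isometric G (I : interval R) : line G -> isometric_on I G.
Proof. by move=> lG s t _ _. Qed.

Lemma line_unique a b G G' : a < b -> line G -> line G' ->
  {in `[a, b], G =1 G'} -> G =1 G'.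
Proof.
move=> ab lG lG' GG'; pose g (t : [set` `[a, b]]) := G (\val t).
have [|H [_ uH]] := straightX (g := g) ab.
  by move=> s t; exact: lG.
have HE F : line F -> {in `[a, b], G =1 F} ->
    H = (fun t : [set` `]-oo, +oo[%R] => F (\val t)).
  move=> lF GF; apply: uH; split => [s t|s t st]; first exact: lF.
  by rewrite /g GF ?st // -st; exact: (set_valP s).
move=> t; have tT : t \in [set` `]-oo, +oo[%R] by rewrite inE /= in_itv.
have := etrans (esym (HE G lG (fun _ _ => erefl))) (HE G' lG' GG').
by move/(congr1 (fun F => F (exist _ t tT))).
Qed.

(** Each initial segment of the ray h extends to a line, and all these lines
    share the segment over [0, m] with G. *)
Lemma ray_extends_line G h m : 0 < m -> line G ->
  isometric_on `[0, +oo[ h -> {in `[0, m], h =1 G} -> {in `[0, +oo[, h =1 G}.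
Proof.
move=> m0 lG hI hG t; rewrite in_itv /= andbT => t0.
have hI' : isometric_on `[0, m + t] h.
  by move=> r s rI sI; apply: hI; move: rI sI; rewrite !in_itv /=; lra.
have [|G' lG' G'h] := straight_line _ hI'; first by lra.
have G'G : G' =1 G.
  apply: (line_unique m0) => // s sI; rewrite G'h ?hG //.
  by move: sI; rewrite !in_itv /=; lra.
by rewrite -G'G G'h // in_itv /=; lra.
Qed.

(** If the way from G (- s) through G 0 to h m has no detour, then the segment
    of G over [- s, 0] followed by h is a geodesic; the line that extends it
    coincides with G by straightness. *)
Lemma ray_continues_line G h s m : 0 < s -> 0 < m -> line G ->
  isometric_on `[0, +oo[ h -> h 0 = G 0 -> s + m <= mdist (G (- s)) (h m) ->
  {in `[0, +oo[, h =1 G}.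
Proof.
move=> s0 m0 lG hI h0 sm.
pose g t := if t <= 0 then G t else h t.
have hE r t : 0 <= r -> 0 <= t -> mdist (h r) (h t) = `|r - t|.
  by move=> r0 t0; apply: hI; rewrite in_itv /= andbT.
have gh t : 0 <= t -> g t = h t.
  rewrite /g; case: (leP t 0) => // t0 t1.
  by have -> : t = 0 by lra.
have dGh r t : - s <= r <= 0 -> 0 <= t <= m -> mdist (G r) (h t) = t - r.
  move=> r0 t0; apply/le_anti/andP; split.
    have := metric_triangle (G r) (G 0) (h t).
    rewrite -{2}h0 lG hE; [|lra|lra].
    by rewrite ler0_norm ?[`|0 - t|]ler0_norm; lra.
  have := metric_triangle (G (- s)) (G r) (h m).
  have := metric_triangle (G r) (h t) (h m).
  rewrite lG hE; [|lra|lra].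
  by rewrite !ler0_norm; lra.
have gI : isometric_on `[- s, m] g.
  move=> r t; rewrite !in_itv /= => rI tI.
  have [r0|r0] := leP r 0; have [t0|t0] := leP t 0.
  - by rewrite /g r0 t0 lG.
  - rewrite (gh t) ?(ltW t0) // {1}/g r0 dGh; [|lra|lra].
    by rewrite ler0_norm; lra.
  - rewrite (gh r) ?(ltW r0) // {1}/g t0 metric_sym dGh; [|lra|lra].
    by rewrite ger0_norm; lra.
  - by rewrite !gh ?ltW // hE ?ltW.
have [|G' lG' G'g] := straight_line _ gI; first by lra.
have G'G : G' =1 G.
  apply: (@line_unique (- s) 0) => // [|t tI]; first by lra.
  rewrite G'g; last by move: tI; rewrite !in_itv /=; lra.
  have t0 : t <= 0 by move: tI; rewrite in_itv /=; lra.
  by rewrite /g t0.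
apply: (ray_extends_line m0) => // t tI.
rewrite -G'G G'g ?gh //; move: tI; rewrite !in_itv /=; lra.
Qed.

Context (geodX : uniquely_geodesic X).

Lemma line_through x y : x <> y ->
  exists2 G, line G & G 0 = x /\ G (mdist x y) = y.
Proof.
move=> xy; have [g [[gI [t0 t00 gt0] [t1 t11 gt1]] _]] := geodX xy.
have xy0 : 0 < mdist x y by rewrite mdist_gt0; exact/eqP.
pose h (t : R) : X := if pselect (t \in [set` `[0, mdist x y]]) is left tI
  then g (exist _ t tI) else x.
have hE (t : [set` `[0, mdist x y]]) : h (\val t) = g t.
  rewrite /h; case: pselect => [tI|]; last by case; exact: (valP t).
  by congr g; exact: val_inj.
have hI : isometric_on `[0, mdist x y] h.
  move=> s t sI tI.
  have := gI (exist _ s (mem_set sI)) (exist _ t (mem_set tI)).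
  by rewrite -!hE.
have [G lG Gh] := straight_line xy0 hI.
exists G => //; split.
  by rewrite Gh ?in_itv /= ?lexx ?ltW // -t00 hE.
by rewrite Gh ?in_itv /= ?lexx ?ltW // -[X in h X]t11 hE.
Qed.

Lemma line_shift G a : line G -> line (fun t => G (t + a)).
Proof. by move=> lG s t; rewrite lG; congr (`| _ |); lra. Qed.

Lemma line_from (x0 x1 x : X) : x0 <> x1 -> exists2 G, line G & G 0 = x.
Proof.
move=> x01; have [xx0|/eqP xx0] := eqVneq x x0.
  have [G lG [G0 _]] := line_through x01.
  by exists G => //; rewrite G0.
by have [G lG [G0 _]] := line_through xx0; exists G.
Qed.

End Lines.

(** * Derivatives of distances along lines *)

Section Derivatives.
Context {R : realType} {X : metricType R}.

Lemma is_derive_has_derivative (I : interval R) (f : R -> R) (t l : R)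
    (tI : t \in [set` I]) : nbhs t [set` I] ->
  has_derivative (fun s : [set` I] => f (\val s)) (exist _ t tI) l ->
  is_derive t 1 f l.
Proof.
move=> It fl.
suff cl : (fun h => h^-1 *: ((f \o shift t) (h *: 1) - f t)) @ 0^' --> l.
  by apply: DeriveDef; [apply/cvg_ex; exists l|exact: cvg_lim cl].
move=> U /fl [_ [[W oW <-] /= Wt WU]].
have /nbhs0P : nbhs t (W `&` [set` I]).
  by apply: filterI It; exact: open_nbhs_nbhs.
apply: filterS => h [Wh Ih] h0.
have /= := WU (exist _ (t + h) (mem_set Ih)) Wh.
have -> : exist _ (t + h) (mem_set Ih) != exist _ t tI.
  by apply: contra_neq h0 => /(congr1 \val) /=; lra.
move=> /(_ isT); congr U.
rewrite /= /GRing.scale /= mulr1 [h + _]addrC mulrC.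
by congr (_^-1 * _); lra.
Qed.

Lemma is_derive_squeeze0 (u e : R -> R) (t : R) :
  is_derive t 1 e 0 -> e t = 0 -> (forall s, `|u s - u t| <= e s) ->
  is_derive t 1 u 0.
Proof.
move=> [de e0'] e0 ue.
have ce : (fun h => h^-1 *: ((e \o shift t) (h *: 1) - e t)) @ 0^' --> (0:R).
  by rewrite -[X in _ --> X]e0'; exact: de.
suff cu : (fun h => h^-1 *: ((u \o shift t) (h *: 1) - u t)) @ 0^' --> (0:R).
  by apply: DeriveDef; [apply/cvg_ex; exists 0|exact: cvg_lim cu].
apply/cvgrPdist_le => d d0; move/cvgrPdist_le : ce => /(_ d d0).
apply: filterS => h; rewrite !sub0r !normrN /= e0 subr0 !normrZ.
apply: le_trans.
apply: ler_wpM2l => //; apply: le_trans (ue _) _; exact: ler_norm.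
Qed.

Context (C1X : C1_along_geodesics X).

Lemma derivable_mdist_line (G : R -> X) t x :
  line G -> G t <> x -> derivable (fun s => mdist (G s) x) t 1.
Proof.
move=> lG /eqP; rewrite -mdist_gt0 => d0.
pose d := mdist (G t) x / 2.
have d2 : d + d = mdist (G t) x by rewrite /d; lra.
pose g (s : [set` `[t - d, t + d]]) := G (\val s).
have ab : t - d < t + d by lra.
have [|D [+ _]] := C1X (g := g) ab.
  by move=> r s; exact: lG.
have tI : t \in `[t - d, t + d] by rewrite in_itv /=; lra.
have ngx : ~ range g x.
  move=> [[r rI] _ /= grx]; have := lG t r.
  rewrite -[G r]/(g (exist _ r rI)) grx -d2.
  move: (rI); rewrite inE /= in_itv /= => rI'; have [tr|tr] := leP t r.
    by rewrite ler0_norm; lra.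
  by rewrite ger0_norm; lra.
have nI : nbhs t [set` `[t - d, t + d]].
  have tI' : t \in `]t - d, t + d[ by rewrite in_itv /=; lra.
  apply: filterS (near_in_itvoo tI') => s; rewrite /= !in_itv /=; lra.
move=> /(_ (exist _ t (mem_set tI)) x ngx).
by case/(is_derive_has_derivative (f := fun s => mdist (G s) x) nI).
Qed.

(** The function is nonnegative by the triangle inequality and vanishes at t, so
    t is a minimum.  It is differentiable near t because G stays away from x
    and y at times closer to t than 1. *)
Lemma is_derive_excess (G : R -> X) t x y :
  line G -> mdist x (G t) = 1 -> mdist (G t) y = 1 -> mdist x y = 2 ->
  is_derive t 1 (fun s => mdist (G s) x + mdist (G s) y - 2) 0.
Proof.
move=> lG xt ty xy.
have near_t z : mdist (G t) z = 1 ->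
    forall s, s \in `]t - 1, t + 1[ -> G s <> z.
  move=> tz s + sz; move: tz; rewrite in_itv /= -sz lG => ts sI.
  move: ts; have [ts|ts] := leP t s; first by rewrite ler0_norm; lra.
  by rewrite ger0_norm; lra.
apply: (@derive1_at_min _ _ (t - 1) (t + 1)); first by lra.
- move=> s sI; apply: derivableB; last exact: derivable_cst.
  apply: derivableD; apply: derivable_mdist_line => //; apply: near_t sI => //.
  by rewrite metric_sym.
- by rewrite in_itv /=; lra.
- move=> s _; rewrite metric_sym xt ty.
  by have := metric_triangle x (G s) y; rewrite xy [mdist x _]metric_sym; lra.
Qed.

End Derivatives.

(** * Spaces of nonexpansive functions *)

Section FunctionSpaces.
Context {R : realType}.

Lemma closed_forall (T : topologicalType) (I : Type) (C : I -> set T) :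
  (forall i, closed (C i)) -> closed [set x | forall i, C i x].
Proof.
move=> cC; have -> : [set x | forall i, C i x] = \bigcap_i C i.
  by apply/seteqP; split => x Cx => [i _|i]; exact: Cx.
by apply: closed_bigI => i _; exact: cC.
Qed.

Lemma closed_fiber (T Y : topologicalType) (f : T -> Y) (y : Y) :
  hausdorff_space Y -> continuous f -> closed [set x | f x = y].
Proof.
move=> hY /continuous_closedP /(_ [set y]); apply.
exact: accessible_closed_set1 (hausdorff_accessible hY) _.
Qed.

Lemma continuous_subr (T : topologicalType) (f g : T -> R) :
  continuous f -> continuous g -> continuous (fun x => f x - g x).
Proof. by move=> cf cg x; apply: cvgB; [exact: cf | exact: cg]. Qed.

Lemma closed_le_fun (T : topologicalType) (f g : T -> R) :
  continuous f -> continuous g -> closed [set x | f x <= g x].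
Proof.
move=> cf cg; have -> : [set x | f x <= g x] = (g \- f) @^-1` [set r | 0 <= r].
  by apply/seteqP; split => x /=; rewrite subr_ge0.
by have /continuous_closedP := continuous_subr cg cf; apply; exact: closed_ge.
Qed.

Lemma continuous_eval (T : topologicalType) (Y : uniformType) (t : T) :
  continuous (fun f : {family compact, T -> Y} => f t).
Proof.
move=> f U; rewrite /= -nbhs_entourageE => -[E entE EU].
have := fam_nbhs f entE (@compact_set1 _ t).
by apply: filterS => g fg; apply: EU; apply/xsectionP; exact: fg.
Qed.

Lemma continuous_eval_sub (T : topologicalType) (Y : uniformType)
    (A : set {family compact, T -> Y}) (t : T) :
  continuous (fun f : A => set_val f t).
Proof.
move=> f U fU; have := @continuous_eval T Y t (set_val f) U fU.
exact: (@initial_continuous A _ set_val f).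
Qed.

Lemma compact_nonexpansive_family (T : pseudoMetricType R) (Y : metricType R)
    (y0 : Y) (W : set {family compact, T -> Y}) :
  (forall f s t e, W f -> ball s e t -> ball (f s) e (f t)) ->
  (forall t, exists2 K, compact K & forall f, W f -> K (f t)) ->
  closed W -> compact W.
Proof.
move=> neW bW clW.
(* Ascoli's theorem takes a target with a base point. *)
pose Yp : puniformType := HB.pack (Metric.sort Y) (isPointed.Build _ y0).
have hY : hausdorff_space Yp by exact: (@metric_hausdorff _ Y).
rewrite ((closure_id W).1 clW) -precompactE.
apply: (@pointwise_precompact_equicontinuous T Yp hY W).
  move=> t; have [K cK WK] := bW t.
  apply: (precompact_subset (B := K)); first by move=> _ [f Wf <-]; exact: WK.
  exact: compact_precompact.
move=> t E; rewrite -entourage_ballE => -[e /= e0 eE].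
have : nbhs t (ball t e) by exact: nbhsx_ballx.
by apply: filterS => s ts f Wf; apply: eE; exact: neW ts.
Qed.

Lemma mdist_lipschitz (X : metricType R) (x y z : X) :
  `|mdist x y - mdist x z| <= mdist y z.
Proof.
rewrite ler_norml; have := metric_triangle x y z; have := metric_triangle x z y.
by rewrite [mdist z y]metric_sym; lra.
Qed.

Lemma continuous_mdist2 (X : metricType R) (T : topologicalType)
    (f g : T -> X) :
  continuous f -> continuous g -> continuous (fun t => mdist (f t) (g t)).
Proof.
move=> cf cg t; apply/cvgrPdist_lt => e e0; have e2 : 0 < e / 2 by lra.
move: (cf t) (cg t) => /metricType_numDomainType.cvgrPdist_lt /(_ _ e2) ft.
move=> /metricType_numDomainType.cvgrPdist_lt /(_ _ e2) gt.
apply: filterS2 ft gt => s fs gs.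
have := mdist_lipschitz (f t) (g t) (g s).
have := mdist_lipschitz (g s) (f t) (f s).
rewrite ![mdist (g s) (f _)]metric_sym => fgs fgt.
have -> : e = e / 2 + e / 2 by lra.
apply: le_lt_trans (ler_distD (mdist (f t) (g s)) _ _) _.
by apply: ltrD; [exact: le_lt_trans fgt _ | exact: le_lt_trans fgs _].
Qed.

(** The extended real line carries by definition the metric that makes
    [contract] an isometry onto [-1, 1]. *)
Lemma compact_extended_nonneg : compact [set r : \bar R | (0 <= r)%E].
Proof.
have cE : compact [set: \bar R].
  have -> : [set: \bar R] = @expand R @` `[(-1)%R, 1%R].
    apply/seteqP; split => // x _; exists (contract x); last exact: contractK.
    by rewrite /= in_itv /= -ler_norml contract_le1.
  apply: continuous_compact; last exact: segment_compact.
  apply/subspace_continuousP => x xI; apply/cvg_ballP => e e0.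
  have inI (y : R) : y \in `[(-1)%R, 1%R] -> y \in [pred r | `|r| <= 1]%R.
    by rewrite /= in_itv /= inE ler_norml.
  have : nbhs x (ball x e) by exact: nbhsx_ballx.
  rewrite near_withinE; apply: filterS => y xy yI.
  by rewrite /ball /= /ereal_ball !expandK ?inI.
by apply: (subclosed_compact _ cE) => //; exact: closed_ereal_le_ereal.
Qed.

End FunctionSpaces.

(** * Rays and polar coordinates *)

Section Rays.
Context {R : realType} {X : metricType R} {b : X}.
Implicit Types (h : rays b) (s t : R) (r : [set r : \bar R | (0 <= r)%E]).

Lemma clamp_subproof t : Num.max 0 t \in [set` `[0 : R, +oo[].
Proof. by rewrite inE /= in_itv /= andbT le_max lexx. Qed.

Lemma clamp_lipschitz s t : `|Num.max 0 s - Num.max 0 t| <= `|s - t|.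
Proof.
have := ler_norm (s - t); have := ler_norm (t - s); rewrite distrC ler_norml.
by rewrite !maxEle; case: (leP 0 s); case: (leP 0 t); lra.
Qed.

Definition clamp t : [set` `[0 : R, +oo[] :=
  exist _ (Num.max 0 t) (clamp_subproof t).

(** Rays extended by a constant to negative times, to have them as functions on
    the reals. *)
Definition ray_at h t : X := set_val h (clamp t).

Lemma ray_atE h t (tI : t \in [set` `[0 : R, +oo[]) :
  set_val h (exist _ t tI) = ray_at h t.
Proof.
rewrite /ray_at; congr (set_val h _); apply: val_inj => /=.
by move: tI; rewrite inE /= in_itv /= andbT => /max_idPr.
Qed.

Lemma mdist_ray_at h s t : 0 <= s -> 0 <= t ->
  mdist (ray_at h s) (ray_at h t) = `|s - t|.
Proof.
move=> s0 t0; have [hI _] := set_valP h.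
by rewrite hI /= !max_r.
Qed.

Lemma mdist_ray_at_le h s t : mdist (ray_at h s) (ray_at h t) <= `|s - t|.
Proof. by have [hI _] := set_valP h; rewrite hI; exact: clamp_lipschitz. Qed.

Lemma ray_at_isometric h : isometric_on `[0, +oo[ (ray_at h).
Proof.
by move=> s t; rewrite !in_itv /= !andbT => s0 t0; exact: mdist_ray_at.
Qed.

Lemma ray_at0 h : ray_at h 0 = b.
Proof.
have [_ [t t0 ht]] := set_valP h.
rewrite -ht /ray_at; congr (set_val h _); apply: val_inj.
by rewrite /= maxxx.
Qed.

Lemma ray_ext h h' : {in `[0, +oo[, ray_at h =1 ray_at h'} -> h = h'.
Proof.
move=> hh'; apply: val_inj; apply/funext => -[t tI].
have := hh' t; rewrite -!(ray_atE _ tI); apply.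
by move: tI; rewrite inE.
Qed.

Lemma ray_of_isometric (g : R -> X) : isometric_on `[0, +oo[ g -> g 0 = b ->
  exists h, {in `[0, +oo[, ray_at h =1 g}.
Proof.
move=> gI g0.
pose g' : {family compact, [set` `[0 : R, +oo[] -> X} :=
  fun t : [set` `[0 : R, +oo[] => g (\val t).
have g'r : rays b g'.
  split.
    by move=> s t; apply: gI; [exact: (set_valP s)|exact: (set_valP t)].
  by exists (clamp 0); rewrite /g' /= maxxx.
exists (exist _ g' (mem_set g'r)) => t; rewrite in_itv /= andbT => t0.
by congr g; exact: max_r.
Qed.

Lemma continuous_ray_at : continuous (fun z : rays b * R => ray_at z.1 z.2).
Proof.
move=> [h t]; apply/metricType_numDomainType.cvgrPdist_lt => e e0.
have e2 : 0 < e / 2 by lra.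
have ch : continuous (fun h => ray_at h t) by exact: continuous_eval_sub.
have nh : nbhs h [set h' | mdist (ray_at h t) (ray_at h' t) < e / 2].
  by move: (ch h) => /metricType_numDomainType.cvgrPdist_lt /(_ _ e2).
exists ([set h' | mdist (ray_at h t) (ray_at h' t) < e / 2], ball t (e / 2)).
  by split => //=; exact: nbhsx_ballx.
move=> [h' t'] [/= hh' tt'].
apply: le_lt_trans (metric_triangle _ (ray_at h' t) _) _.
have -> : e = e / 2 + e / 2 by lra.
apply: ltrD => //; apply: le_lt_trans tt'.
exact: mdist_ray_at_le.
Qed.

Lemma compact_rays : proper_space X -> compact [set: rays b].
Proof.
move=> pX; apply: compact_set_type.
apply: (compact_nonexpansive_family b).
- move=> f s t e [fI _]; rewrite !ballEmdist /= fI; exact.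
- move=> t; exists [set y | mdist b y <= \val t]; first exact: pX.
  move=> f [fI [u u0 fu]] /=; rewrite -fu fI u0 sub0r normrN ger0_norm //.
  by have := set_valP t; rewrite /= in_itv /= andbT.
- have -> : rays b =
      [set f : {family compact, [set` `[0 : R, +oo[] -> X} |
        forall st, mdist (f st.1) (f st.2) = `|\val st.1 - \val st.2|] `&`
      [set f | f (clamp 0) = b].
    apply/seteqP; split => f [fI fb].
      split => [st|]; first exact: fI.
      case: fb => t t0 <- /=; congr f; apply: val_inj.
      by rewrite /= maxxx.
    split => [s t|]; first exact: (fI (s, t)).
    by exists (clamp 0) => //=; rewrite maxxx.
  apply: closedI.
    apply: closed_forall => st.
    apply: (closed_fiber (f := fun f : {family compact, _ -> X} =>
      mdist (f st.1) (f st.2))); first exact: Rhausdorff.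
    by apply: continuous_mdist2; exact: continuous_eval.
  apply: (closed_fiber (f := fun f : {family compact, _ -> X} => f (clamp 0))).
    exact: metric_hausdorff.
  exact: continuous_eval.
Qed.

Lemma continuous_polar : continuous (@polar R X b).
Proof. by apply/continuousP => U. Qed.

Lemma polar_fin h r t : \val r = t%:E -> polar (h, r) = inl (ray_at h t).
Proof.
case: r => r rI /= rt; move: rI; rewrite rt => rI.
by congr inl; exact: ray_atE.
Qed.

Lemma polar_infty h r : \val r = +oo%E -> polar (h, r) = inr h.
Proof. by case: r => r rI /= rt; move: rI; rewrite rt => rI. Qed.

End Rays.

(** * Visual compactifications are Hausdorff *)

Section VisualHausdorff.
Context {R : realType} {X : metricType R} {b : X}.
Local Notation radius := [set r : \bar R | (0 <= r)%E].
Implicit Types (h : rays b) (r : radius) (t : R).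

Definition truncated (t : R) (r : \bar R) : R :=
  if r is r'%:E then Num.min t r' else t.

Lemma continuous_truncated t :
  continuous (fun r : radius => truncated t (\val r)).
Proof.
move=> r U; case: r => r rI.
have : nbhs (truncated t r) U -> nbhs r (truncated t @^-1` U).
  have := set_mem rI; case: r {rI} => [r _|_|] //= tU.
    apply/nbhs_EFin.
    have cm : {for r, continuous (@cst R R t \min id)}.
      by apply: continuous_min; [exact: cst_continuous | exact: cvg_id].
    exact: (cm U tU).
  exists t; split; first exact: num_real.
  case=> [s|//|//] ts /=; last exact: nbhs_singleton.
  by rewrite min_l; [exact: nbhs_singleton | rewrite -lee_fin ltW].
move=> + tU => /(_ tU) rU.
exact: (@initial_continuous radius _ set_val (exist _ r rI) _ rU).
Qed.

Lemma continuous_ray_truncated t : continuous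
  (fun z : rays b * radius => ray_at z.1 (truncated t (\val z.2))).
Proof.
move=> z; apply: (@continuous_comp _ (rays b * R)%type _
  (fun z : rays b * radius => (z.1, truncated t (\val z.2)))
  (fun z => ray_at z.1 z.2)); last exact: continuous_ray_at.
have c2 : truncated t (\val y.2) @[y --> z] --> truncated t (\val z.2).
  apply: (@continuous_comp _ radius R snd
    (fun r : radius => truncated t (\val r))); first exact: cvg_snd.
  exact: continuous_truncated.
have c1 : y.1 @[y --> z] --> z.1 by exact: cvg_fst.
exact: (cvg_pair (FF := _) c1 c2).
Qed.

Context (geodX : uniquely_geodesic X).

Lemma geodesic_unique (g g' : R -> X) (l : R) : 0 <= l ->
  isometric_on `[0, l] g -> isometric_on `[0, l] g' ->
  g 0 = g' 0 -> g l = g' l -> {in `[0, l], g =1 g'}.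
Proof.
rewrite le_eqVlt => /orP[/eqP <- _ _ g0 _ t|l0 gI gI' g0 gl t tI].
  by rewrite in_itv /= => /le_anti <-.
have dl : mdist (g 0) (g l) = l.
  rewrite gI ?in_itv /= ?lexx ?ltW // sub0r normrN gtr0_norm //.
have ne : g 0 <> g l by apply/eqP; rewrite -mdist_gt0 dl.
have [G [_ uG]] := geodX ne.
have HG (f : R -> X) : isometric_on `[0, l] f -> f 0 = g 0 -> f l = g l ->
    G = fun s : [set` `[0, mdist (g 0) (g l)]] => f (\val s).
  move=> fI f0 fl; apply: uG; split.
  - move=> [r rI] [s sI]; apply: fI => /=.
      by move: rI; rewrite inE /= dl.
    by move: sI; rewrite inE /= dl.
  - have I0 : (0:R) \in [set` `[0, mdist (g 0) (g l)]].
      by rewrite inE /= in_itv /= lexx mdist_ge0.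
    by exists (exist _ 0 I0).
  - have Il : l \in [set` `[0, mdist (g 0) (g l)]].
      by rewrite inE /= in_itv /= dl lexx ltW.
    by exists (exist _ l Il); rewrite //= dl.
have tI' : t \in [set` `[0, mdist (g 0) (g l)]] by rewrite inE /= dl.
have := etrans (esym (HG g gI erefl erefl)) (HG g' gI' (esym g0) (esym gl)).
by move/(congr1 (fun F => F (exist _ t tI'))).
Qed.

Lemma polar_inl (z : rays b * radius) x : polar z = inl x -> exists2 r : R,
  \val z.2 = r%:E & 0 <= r /\ ray_at z.1 r = x.
Proof.
case: z => h r; have := set_valP r.
case rE : (\val r) => [s||] //=; last by rewrite polar_infty.
by rewrite (polar_fin _ rE) => s0 [hx]; exists s.
Qed.

Lemma polar_inr (z : rays b * radius) h :
  polar z = inr h -> \val z.2 = +oo%E /\ z.1 = h.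
Proof.
case: z => h' r; have := set_valP r.
case rE : (\val r) => [s||] //=; first by rewrite (polar_fin _ rE).
by rewrite (polar_infty _ rE) => _ [->].
Qed.

Lemma mdist_ray_at_origin h t : 0 <= t -> mdist b (ray_at h t) = t.
Proof.
move=> t0; rewrite -{1}(ray_at0 h) mdist_ray_at // sub0r normrN ger0_norm //.
Qed.

(** For v in X, the point at distance at most t from b on the geodesic from b to
    v; for a ray v, the point v(t).  These maps, for all t, separate the points
    of the visual compactification. *)
Definition truncation t (v : visual b) : X :=
  if pselect (exists z, polar z = v) is left e
  then let z := sval (cid e) in ray_at z.1 (truncated t (\val z.2)) else b.

(** Polar coordinates with the same image parametrize the same geodesic, up to
    its endpoint: this is where geodesics have to be unique. *)
Lemma truncation_polar t (z : rays b * radius) : 0 <= t ->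
  truncation t (polar z) = ray_at z.1 (truncated t (\val z.2)).
Proof.
move=> t0; rewrite /truncation; case: pselect => [e|]; last by case; exists z.
case: cid => z' /= zz'; case vE : (polar z) => [x|h].
  have [r rE [r0 rx]] := polar_inl vE.
  have [r' rE' [r0' rx']] := polar_inl (etrans zz' vE).
  have rr' : r' = r.
    rewrite -(mdist_ray_at_origin z'.1 r0') -(mdist_ray_at_origin z.1 r0).
    by rewrite rx rx'.
  rewrite rE rE' rr' /=.
  have sub h : isometric_on `[0, r] (ray_at h).
    move=> s u sI uI; apply: ray_at_isometric;
      by move: sI uI; rewrite !in_itv /=; lra.
  apply: (geodesic_unique r0) => //; first by rewrite !ray_at0.
    by rewrite rx -rr' rx'.
  by rewrite in_itv /= le_min t0 r0 ge_min lexx orbT.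
have [rE hE] := polar_inr vE; have [rE' hE'] := polar_inr (etrans zz' vE).
by rewrite rE rE' hE hE'.
Qed.

Lemma continuous_truncation t : 0 <= t -> continuous (truncation t).
Proof.
move=> t0; apply/continuousP => U oU.
have := (continuousP _).1 (@continuous_ray_truncated t) U oU.
congr open; apply/seteqP; split => z; rewrite /preimage /= truncation_polar //.
Qed.

Lemma hausdorff_visual : (forall v : visual b, exists z, polar z = v) ->
  hausdorff_space (visual b).
Proof.
move=> polar_onto; apply: separated_hausdorff => v w vw.
suff [t t0 ne] : exists2 t, 0 <= t & truncation t v <> truncation t w.
  by exists X, (truncation t); split => //; [exact: metric_hausdorff|
     exact: continuous_truncation].
apply: contrapT => /forall2NP nt.
have {}nt t : 0 <= t -> truncation t v = truncation t w.
  by move=> t0; have [//|/contrapT] := nt t.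
apply: vw; have [[h r] zv] := polar_onto v; have [[h' r'] zw] := polar_onto w.
have {}nt t : 0 <= t ->
    ray_at h (truncated t (\val r)) = ray_at h' (truncated t (\val r')).
  by move=> /[dup] t0 /nt; rewrite -zv -zw !truncation_polar.
(* A geodesic that stops at time s is told from a ray at time s + 1. *)
rewrite -zv -zw; have mixed (h1 h2 : rays b) (s : R) : 0 <= s ->
    ray_at h1 (truncated (s + 1) s%:E) <> ray_at h2 (s + 1).
  move=> s0 /(congr1 (mdist b)); rewrite /= min_r; last by lra.
  by rewrite !mdist_ray_at_origin; lra.
have := set_valP r; have := set_valP r'; move: nt.
case rE : (\val r) => [s||] //=; case rE' : (\val r') => [s'||] //= nt.
- rewrite !lee_fin => s'0 s0; rewrite (polar_fin _ rE) (polar_fin _ rE').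
  (* At time s + s' both geodesics have reached their endpoints. *)
  have := nt (s + s'); rewrite !min_r; [|lra|lra].
  by move=> ->//; lra.
- move=> _; rewrite lee_fin => s0; case: (mixed h h' s s0).
  by apply: nt; lra.
- rewrite lee_fin => s'0 _; case: (mixed h' h s' s'0).
  by apply/esym; apply: nt; lra.
- move=> _ _; rewrite (polar_infty _ rE) (polar_infty _ rE'); congr inr.
  by apply: ray_ext => t; rewrite in_itv /= andbT => /nt.
Qed.

End VisualHausdorff.

(** * The space of horofunctions *)

Section Horofunctions.
Context {R : realType} {X : metricType R} {o : X}.
Local Notation H := (horofunction_compactification o).
Implicit Types (f : H) (x y : X).

Definition horo f x : R := set_val (set_val f) x.

Lemma horo_embedding x y :
  horo (horofunction_embedding o x) y = mdist x y - mdist x o.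
Proof. by []. Qed.

Lemma continuous_horo x : continuous (horo^~ x).
Proof.
move=> f; apply: (@continuous_comp _ _ _ set_val
  (fun g : @continuous_functions R X => set_val g x)).
  exact: initial_continuous.
exact: continuous_eval_sub.
Qed.

(** The induction principle behind every statement on limits of distance
    functions below: the points of X are dense. *)
Lemma horofunction_limit (C : set H) : closed C ->
  (forall x, C (horofunction_embedding o x)) -> forall f, C f.
Proof.
move=> cC Cx f; apply: contrapT => nCf.
have [|g [nCg [x _ xg]]] :=
    @dense_to_closure X _ (horofunction o) (~` C) _ (closed_openC cC).
  by exists f.
by apply: nCg; rewrite -xg; exact: Cx.
Qed.

Lemma horo_lipschitz f x y : horo f x - horo f y <= mdist x y.
Proof.
move: f; apply: horofunction_limit.
  apply: (closed_le_fun (f := fun f => horo f x - horo f y)).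
    by apply: continuous_subr; exact: continuous_horo.
  by move=> ?; exact: cst_continuous.
move=> z /=; rewrite !horo_embedding.
have := ler_norm (mdist z x - mdist z y); have := mdist_lipschitz z x y; lra.
Qed.

Lemma horo_base f : horo f o = 0.
Proof.
move: f; apply: horofunction_limit.
  by apply: closed_fiber; [exact: Rhausdorff|exact: continuous_horo].
by move=> z /=; rewrite horo_embedding subrr.
Qed.

Lemma horo_inj f g : horo f =1 horo g -> f = g.
Proof. by move=> fg; do 2 apply: val_inj; exact/funext. Qed.

Lemma continuous_horo_pair (T : topologicalType) (u : T -> X) (v : T -> H) :
  continuous u -> continuous v -> continuous (fun t => horo (v t) (u t)).
Proof.
move=> cu cv t; apply/cvgrPdist_lt => e e0; have e2 : 0 < e / 2 by lra.
move: (cu t) => /metricType_numDomainType.cvgrPdist_lt /(_ _ e2) ut.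
have : horo (v s) (u t) @[s --> t] --> horo (v t) (u t).
  apply: (@continuous_comp _ _ _ v (horo^~ (u t))); first exact: cv.
  exact: continuous_horo.
move=> /cvgrPdist_lt /(_ _ e2) vt.
apply: filterS2 ut vt => s us vs.
have -> : e = e / 2 + e / 2 by lra.
apply: le_lt_trans (ler_distD (horo (v s) (u t)) _ _) _.
apply: ltrD => //; apply: le_lt_trans us.
rewrite ler_norml; have := horo_lipschitz (v s) (u t) (u s).
have := horo_lipschitz (v s) (u s) (u t).
by rewrite [mdist (u s) _]metric_sym; lra.
Qed.

Context (properX : proper_space X).

Lemma compact_horofunctions : compact [set: H].
Proof.
pose W := [set f : {family compact, X -> R} |
  (forall xy, f xy.1 - f xy.2 <= mdist xy.1 xy.2)] `&` [set f | f o = 0].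
have cW : compact W.
  apply: (@compact_nonexpansive_family R X R^o 0).
  - move=> f x y e [fL _]; rewrite !ballEmdist /=; apply: le_lt_trans.
    rewrite -[mdist (f x) _]/(`|f y - f x|) ler_norml.
    have := fL (x, y); have := fL (y, x).
    by rewrite /= [mdist y x]metric_sym; lra.
  - move=> x; exists [set` `[- mdist o x, mdist o x]].
      exact: segment_compact.
    move=> f [fL fo]; have := fL (x, o); have := fL (o, x).
    by rewrite /= in_itv /= fo [mdist x o]metric_sym; lra.
  - apply: closedI.
      apply: closed_forall => xy; apply: closed_le_fun.
        by apply: continuous_subr; exact: continuous_eval.
      by move=> ?; exact: cst_continuous.
    apply: (closed_fiber (f := fun f : {family compact, X -> R} => f o)).
      exact: Rhausdorff.
    exact: continuous_eval.
apply: compact_set_type.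
have WC : W `<=` [set f : {family compact, X -> R} | continuous (f : X -> R)].
  move=> f [fL _] x; apply/cvgrPdist_lt => e e0.
  have : nbhs x (ball x e) by exact: nbhsx_ballx.
  apply: filterS => y; rewrite ballEmdist /=; apply: le_lt_trans.
  rewrite ler_norml; have := fL (x, y); have := fL (y, x).
  by rewrite /= [mdist y x]metric_sym; lra.
apply: (subclosed_compact (@closed_closure _ _) (compact_set_val WC cW)).
move=> f fh.
pose f' : H := exist _ f (mem_set fh).
split; last exact: (horo_base f').
by move=> xy; exact: (horo_lipschitz f').
Qed.

End Horofunctions.

(** * The horofunction compactification of X *)

Section HorofunctionCompactification.
Context {R : realType} {X : metricType R} {o : X}.
Local Notation H := (horofunction_compactification o).
Local Notation iota := (horofunction_embedding o).
Implicit Types (f : H) (x y : X) (e : R).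

Context (properX : proper_space X).
Context (straightX : straight X).
Context (geodX : uniquely_geodesic X).

(** If x' were further than e from x, then the distance to x' would drop by e
    from x to a point at distance e from x, whereas f does not drop at all; the
    two functions cannot be that close to each other. *)
Lemma near_minimum (f : X -> R) x x' e : 0 < e ->
  (forall y, mdist x y <= e -> f x <= f y) ->
  (forall y, mdist x y <= e -> `|horo (iota x') y - f y| < e / 2) ->
  mdist x x' < e.
Proof.
move=> e0 fx x'f; rewrite ltNge; apply/negP => exx'.
have xx' : x <> x' by apply/eqP; rewrite -mdist_gt0; lra.
have [G lG [G0 G1]] := line_through straightX geodX xx'.
have xG : mdist x (G e) = e by rewrite -{1}G0 lG sub0r normrN gtr0_norm.
have x'G : mdist x' (G e) = mdist x x' - e.
  by rewrite -{1}G1 lG ger0_norm // subr_ge0.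
have := fx (G e); have := x'f (G e); have := x'f x.
rewrite !horo_embedding mdistxx xG x'G [mdist x' x]metric_sym !ltr_norml; lra.
Qed.

Lemma nbhs_horo_compact f (K : set X) e : compact K -> 0 < e ->
  \forall g \near f, forall y, K y -> `|horo g y - horo f y| < e.
Proof.
move=> cK e0.
have entE : entourage [set rs : R * R | `|rs.2 - rs.1| < e].
  by rewrite -entourage_ballE; exists e => // -[r s]; rewrite /= distrC.
have := fam_nbhs (set_val (set_val f)) entE cK.
move=> /(@initial_continuous _ _ set_val (set_val f)).
by move=> /(@initial_continuous _ _ set_val f).
Qed.

Lemma horo_approx f (K : set X) e : compact K -> 0 < e ->
  exists x, forall y, K y -> `|horo (iota x) y - horo f y| < e.
Proof.
move=> cK e0.
have : nbhs f [set g : H | forall y, K y -> `|horo g y - horo f y| < e].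
  exact: nbhs_horo_compact.
rewrite nbhsE => -[U [oU Uf] UK].
have [|g [Ug [x _ xg]]] := @dense_to_closure X _ (horofunction o) U _ oU.
  by exists f.
by exists x; have := UK _ Ug; rewrite -xg.
Qed.

(** The functions of points x' that approximate f well near x have x' close to
    x, so they also approximate the function of x. *)
Lemma horo_minimum f x : (forall y, horo f x <= horo f y) -> f = iota x.
Proof.
move=> fx; apply: horo_inj => y; apply/eqP; rewrite -subr_eq0 -normr_le0.
apply/ler_addgt0Pl => e e0; rewrite addr0.
pose r := mdist x y + e / 3 + mdist x o.
have e3 : 0 < e / 3 / 2 by lra.
have [x' x'f] := horo_approx f (@properX x r) e3.
have xy0 := mdist_ge0 x y; have xo0 := mdist_ge0 x o.
have xx' : mdist x x' < e / 3.
  apply: (@near_minimum (horo f)); [lra|by move=> ? _|].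
  by move=> z xz; apply: x'f => /=; rewrite /r; lra.
have := x'f y; rewrite /= /r => /(_ ltac:(lra)).
rewrite !horo_embedding ltr_norml ler_norml.
have := mdist_lipschitz y x x'; have := mdist_lipschitz o x x'.
rewrite !ler_norml ![mdist y _]metric_sym ![mdist o _]metric_sym; lra.
Qed.

Lemma continuous_horofunction_embedding : continuous iota.
Proof.
do 2 apply: continuous_into_set_type.
move=> x; apply/fam_cvgP => K cK U.
rewrite uniform_nbhs => -[E [entE EU]].
move: entE; rewrite -entourage_ballE => -[e /= e0 eE].
have e2 : 0 < e / 2 by lra.
have : nbhs x (ball x (e / 2)) by exact: nbhsx_ballx.
apply: filterS => x'; rewrite ballEmdist /= => xx'; apply: EU => y Ky.
apply: eE; suff: `|horo (iota x) y - horo (iota x') y| < e by [].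
rewrite !horo_embedding.
have := mdist_lipschitz y x x'; have := mdist_lipschitz o x x'.
rewrite ltr_norml !ler_norml ![mdist y _]metric_sym ![mdist o _]metric_sym; lra.
Qed.

Lemma horofunction_is_compactification : is_compactification iota.
Proof.
split; [exact: compact_horofunctions| |exact: dense_to_closure].
have nearby x (U : set X) : nbhs x U ->
    \forall g \near iota x, forall x', g = iota x' -> U x'.
  rewrite -metricType_numDomainType.filter_from_mdist_nbhs => -[e /= e0 eU].
  have e2 : 0 < e / 2 by lra.
  have := nbhs_horo_compact (iota x) (@properX x e) e2.
  apply: filterS => g gx x' gx'; apply: eU.
  apply: (@near_minimum (horo (iota x))) => // [y _|y xy].
    by rewrite !horo_embedding mdistxx; have := mdist_ge0 x y; lra.
  by rewrite -gx'; exact: gx.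
split; first exact: continuous_horofunction_embedding.
  move=> x x' xx'.
  have := horo_embedding (o := o) x x'; have := horo_embedding (o := o) x x.
  rewrite xx' !horo_embedding !mdistxx [mdist x' x]metric_sym => e1 e2.
  by apply: mdist_positivity; lra.
move=> U oU; exists (\bigcup_(x in U) interior
    [set g | forall x', g = iota x' -> U x']).
  by apply: bigcup_open => x _; exact: open_interior.
apply/seteqP; split => [_ [x Ux <-]|g [[x Ux gx] [x' _ x'g]]].
  split; last by exists x.
  by exists x => //; apply: nearby; exact: open_nbhs_nbhs.
by exists x' => //; apply: (nbhs_singleton gx); rewrite x'g.
Qed.

End HorofunctionCompactification.

(** * Directions of steepest descent *)

Section Gradient.
Context {R : realType} {X : metricType R} {o : X}.
Local Notation H := (horofunction_compactification o).
Local Notation iota := (horofunction_embedding o).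
Local Notation radius := [set r : \bar R | (0 <= r)%E].
Implicit Types (f : H) (p x y : X).

(** Along the ray, f decreases at unit speed up to the time r = zf.1.2, and f is
    at least f p - r everywhere.  The second clause is vacuous for r = +oo and
    says for finite r that the endpoint is a minimum.  Both clauses are stated
    with strict inequalities on real times, which makes the relation closed. *)
Definition gradient p : set ((rays p * radius) * H) :=
  [set zf | (forall t : R, (t%:E < \val zf.1.2)%E ->
               horo zf.2 (ray_at zf.1.1 t) <= horo zf.2 p - t) /\
            (forall (t : R) y, (\val zf.1.2 < t%:E)%E ->
               horo zf.2 p - t <= horo zf.2 y)].

Lemma closed_gradient p : closed (@gradient p).
Proof.
have c2 : continuous (fun zf : (rays p * radius) * H => zf.2).
  by move=> zf; exact: cvg_snd.
have cr : continuous (fun zf : (rays p * radius) * H => \val zf.1.2).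
  move=> zf; apply: (@continuous_comp _ radius _ (fun zf => zf.1.2) set_val).
    apply: (@continuous_comp _ (rays p * radius)%type _ fst snd).
      exact: cvg_fst.
    exact: cvg_snd.
  exact: initial_continuous.
have ch t : continuous (fun zf : (rays p * radius) * H => ray_at zf.1.1 t).
  move=> zf.
  apply: (@continuous_comp _ (rays p) _ (fun zf => zf.1.1) (ray_at^~ t)).
    apply: (@continuous_comp _ (rays p * radius)%type _ fst fst).
      exact: cvg_fst.
    exact: cvg_fst.
  exact: continuous_eval_sub.
have cp y : continuous (fun zf : (rays p * radius) * H => horo zf.2 y).
  by apply: continuous_horo_pair => // ?; exact: cst_continuous.
apply: closedI.
  apply: closed_forall => t.
  have -> : (fun zf : (rays p * radius) * H => (t%:E < \val zf.1.2)%E ->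
      horo zf.2 (ray_at zf.1.1 t) <= horo zf.2 p - t) =
    [set zf | (\val zf.1.2 <= t%:E)%E] `|`
    [set zf | horo zf.2 (ray_at zf.1.1 t) <= horo zf.2 p - t].
    apply/seteqP; split => zf /=.
      by case: (leP (\val zf.1.2) t%:E) => [|_ /(_ isT)]; [left|right].
    by case=> // + tr; rewrite leNgt tr.
  apply: closedU.
    move: cr => /continuous_closedP /(_ [set x | (x <= t%:E)%E]); apply.
    exact: closed_ereal_ge_ereal.
  apply: closed_le_fun; first exact: continuous_horo_pair.
  by apply: continuous_subr => // ?; exact: cst_continuous.
apply: closed_forall => t; apply: closed_forall => y.
have -> : (fun zf : (rays p * radius) * H => (\val zf.1.2 < t%:E)%E ->
    horo zf.2 p - t <= horo zf.2 y) =
  [set zf | (t%:E <= \val zf.1.2)%E] `|`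
  [set zf | horo zf.2 p - t <= horo zf.2 y].
  apply/seteqP; split => zf /=.
    by case: (leP t%:E (\val zf.1.2)) => [|_ /(_ isT)]; [left|right].
  by case=> // + tr; rewrite leNgt tr.
apply: closedU.
  move: cr => /continuous_closedP /(_ [set x | (t%:E <= x)%E]); apply.
  exact: closed_ereal_le_ereal.
apply: closed_le_fun => //.
by apply: continuous_subr => // ?; exact: cst_continuous.
Qed.

Context (properX : proper_space X).
Context (straightX : straight X).
Context (geodX : uniquely_geodesic X).
(* A one-point space contains no ray. *)
Context (x0 x1 : X).
Context (x01 : x0 <> x1).

Lemma line_to p x : exists2 G : R -> X, line G & G 0 = p /\ G (mdist p x) = x.
Proof.
have [<-|/eqP px] := eqVneq p x; last exact: line_through.
have [G lG G0] := line_from straightX geodX p x01.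
by exists G => //; rewrite mdistxx.
Qed.

Lemma ray_to p x : exists h : rays p, ray_at h (mdist p x) = x.
Proof.
have [G lG [G0 G1]] := line_to p x.
have [h hG] := ray_of_isometric (line_isometric lG) G0.
by exists h; rewrite hG // in_itv /= andbT mdist_ge0.
Qed.

Lemma ray_at_neg p (h : rays p) (t : R) : t <= 0 -> ray_at h t = p.
Proof.
move=> t0; rewrite -[RHS](ray_at0 h) /ray_at; congr (set_val h _).
by apply: val_inj; rewrite /= maxxx max_l.
Qed.

(** The descent of the distance to x is the geodesic to x. *)
Lemma gradient_embedding p x : exists2 z, @gradient p (z, iota x) &
  polar z = inl x.
Proof.
have [h hx] := ray_to p x.
have rI : (mdist p x)%:E \in radius by rewrite inE /= lee_fin mdist_ge0.
exists (h, exist _ (mdist p x)%:E rI); last first.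
  by rewrite -[in RHS]hx; exact: polar_fin.
split => [t|t y] /=; rewrite lte_fin => tr; rewrite !horo_embedding.
  have [t0|t0] := leP t 0.
    by rewrite ray_at_neg //; lra.
  rewrite -{1}hx mdist_ray_at ?mdist_ge0 ?(ltW t0) //.
  by rewrite ger0_norm ?[mdist x p]metric_sym; lra.
by have := mdist_ge0 x y; rewrite [mdist x p]metric_sym; lra.
Qed.

Lemma polar_onto p (v : visual p) : exists z, polar z = v.
Proof.
case: v => [x|h].
  by have [z _ zx] := gradient_embedding p x; exists z.
have yI : +oo%E \in radius by rewrite inE /= leey.
by exists (h, exist _ +oo%E yI); exact: polar_infty.
Qed.

Lemma compact_polar_domain p : compact [set: rays p * radius].
Proof.
rewrite -setXTT; apply: compact_setX; first exact: compact_rays.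
exact: compact_set_type compact_extended_nonneg.
Qed.

Lemma gradient_exists p f : exists z, @gradient p (z, f).
Proof.
suff [z _ zf] : [set g | exists2 z, setT z & @gradient p (z, g)] f by exists z.
apply: horofunction_limit => [|x].
  apply: closed_projection; first exact: compact_polar_domain.
  exact: closed_gradient.
by have [z zx _] := gradient_embedding p x; exists z.
Qed.

(** For the function of x, the point q lies on the prolongation beyond p of the
    geodesic from x to p.  In the projection below, q ranges over the closed
    ball of radius 1, on whose boundary it lies by the Lipschitz bound. *)
Lemma ascent_exists p f : exists q, mdist q p = 1 /\ horo f q = horo f p + 1.
Proof.
suff [q pq fq] : [set g | exists2 q, mdist p q <= 1 &
    horo g q - horo g p = 1] f.
  exists q; split; last by lra.
  by have := horo_lipschitz f q p; rewrite [mdist q p]metric_sym; lra.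
apply: horofunction_limit => [|x].
  apply: (@closed_projection X H [set q | mdist p q <= 1]
    [set qg | horo qg.2 qg.1 - horo qg.2 p = 1]); first exact: properX.
  apply: (closed_fiber (f := fun qg => horo qg.2 qg.1 - horo qg.2 p)).
    exact: Rhausdorff.
  have c1 : continuous (@fst X H) by move=> z; exact: cvg_fst.
  have c2 : continuous (@snd X H) by move=> z; exact: cvg_snd.
  apply: continuous_subr; apply: continuous_horo_pair => // z.
  exact: cst_continuous.
have [G lG [G0 G1]] := line_to x p.
exists (G (mdist x p + 1)).
  by rewrite -[X in mdist X _]G1 lG ler0_norm; lra.
rewrite !horo_embedding -{1}G0 lG ler0_norm; have := mdist_ge0 x p; lra.
Qed.

(** From q to the point at time m of a descending geodesic, f drops by 1 + m, so
    that these points are at least that far apart and the geodesic continues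
    the line from q to p. *)
Lemma ascent_gradient_line p f q : mdist q p = 1 -> horo f q = horo f p + 1 ->
  exists2 G : R -> X, line G & G (- 1) = q /\
    forall z, @gradient p (z, f) -> (0 < \val z.2)%E ->
      {in `[0, +oo[, ray_at z.1 =1 G}.
Proof.
move=> qp fq; have qp' : q <> p by apply/eqP; rewrite -mdist_gt0 qp.
have [G lG [G0 G1]] := line_through straightX geodX qp'.
exists (fun t => G (t + 1)); first exact: line_shift.
split; first by rewrite addNr.
move=> z [dz _] r0.
have [m m0 mr] : exists2 m : R, 0 < m & (m%:E < \val z.2)%E.
  move: r0; case: (\val z.2) => [s|_|//].
    by rewrite lte_fin => s0; exists (s / 2); rewrite ?lte_fin; lra.
  by exists 1; rewrite ?ltey.
have {dz} := dz m mr; rewrite /= => dz.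
apply: (@ray_continues_line _ _ straightX _ _ 1 m) => //.
- exact: line_shift.
- exact: ray_at_isometric.
- by rewrite ray_at0 add0r -qp G1.
- by rewrite addNr G0; have := horo_lipschitz f q (ray_at z.1 m); lra.
Qed.

(** Equal lengths come from comparing the minimum of f with its descent; equal
    rays of positive length from the line in [ascent_gradient_line].  When the
    length is 0 the rays may differ, but [polar] forgets them. *)
Lemma gradient_unique p f z z' : @gradient p (z, f) -> @gradient p (z', f) ->
  polar z = polar z'.
Proof.
have le_r (w w' : rays p * radius) :
    @gradient p (w, f) -> @gradient p (w', f) -> (\val w'.2 <= \val w.2)%E.
  move=> [_ dw] [dw' _]; rewrite leNgt; apply/negP => ww'.
  have [s [t [ws st tw']]] : exists s t : R, 
      [/\ (\val w.2 < s%:E)%E, s < t & (t%:E < \val w'.2)%E].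
    have w0 := set_valP w.2; move: ww' w0.
    case: (\val w.2) => [u||] //=; case: (\val w'.2) => [v||] //=.
      rewrite lte_fin => uv _; exists (u + (v - u) / 3), (u + (v - u) / 2).
      by rewrite !lte_fin; split; lra.
    move=> _ _; exists (u + 1), (u + 2).
    by rewrite lte_fin ltey; split => //; lra.
  by have := dw s (ray_at w'.1 t) ws; have := dw' t tw' => /=; lra.
move=> gz gz'; have rr' : z.2 = z'.2.
  by apply: val_inj; apply/le_anti; rewrite !le_r.
case: z z' rr' gz gz' => [h r] [h' r'] /= <- gz gz'.
have [r0|r0] := leP (\val r) 0%E.
  have rE : \val r = 0%E by apply/le_anti; rewrite r0; exact: (set_valP r).
  by rewrite !(polar_fin _ rE) !ray_at0.
have [q [qp fq]] := ascent_exists p f.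
have [G _ [_ zG]] := ascent_gradient_line qp fq.
congr (polar (_, r)); apply: ray_ext => t tI.
by rewrite (zG _ gz) // (zG _ gz').
Qed.

Definition direction f p : visual p := polar (sval (cid (gradient_exists p f))).

Lemma direction_gradient p f z : @gradient p (z, f) -> polar z = direction f p.
Proof. by rewrite /direction; case: cid => z' gz' /gradient_unique; exact. Qed.

Lemma continuous_direction p : continuous (direction^~ p).
Proof.
apply: (continuous_of_closed_relation (@compact_polar_domain p)
  (@closed_gradient p) (@continuous_polar _ _ p)).
  exact: gradient_exists.
by move=> z f; exact: direction_gradient.
Qed.

Lemma direction_embedding p x : direction (iota x) p = inl x.
Proof.
by have [z /direction_gradient <-] := gradient_embedding p x.
Qed.

End Gradient.

(** * Horofunctions are determined by their directions *)

Section Directions.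
Context {R : realType} {X : metricType R} {o : X}.
Local Notation H := (horofunction_compactification o).
Local Notation iota := (horofunction_embedding o).
Local Notation radius := [set r : \bar R | (0 <= r)%E].
Implicit Types (f g : H) (p x y : X).

Context (properX : proper_space X).
Context (straightX : straight X).
Context (geodX : uniquely_geodesic X).
Context (C1X : C1_along_geodesics X).
Context (x0 x1 : X).
Context (x01 : x0 <> x1).

Local Notation direction := (direction properX straightX geodX x01).

Lemma direction_exists f p :
  exists2 z : rays p * radius, gradient (z, f) & polar z = direction f p.
Proof.
have [z gz] := gradient_exists properX straightX geodX x01 p f.
by exists z => //; exact: direction_gradient.
Qed.

Lemma direction_inl f p x : direction f p = inl x -> f = iota x.
Proof.
have [z [dz mz] <-] := direction_exists f p.
move=> /polar_inl [r rE [r0 hx]].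
have mr y : horo f p - r <= horo f y.
  apply/ler_addgt0Pl => e e0; have := mz (r + e) y.
  by rewrite /= rE lte_fin => /(_ ltac:(lra)); lra.
apply: horo_minimum => // y; apply: le_trans (mr y).
apply/ler_addgt0Pl => e e0; have := dz (r - e / 2).
rewrite /= rE lte_fin => /(_ ltac:(lra)) dr.
have := horo_lipschitz f x (ray_at z.1 (r - e / 2)).
have := mdist_ray_at_le z.1 r (r - e / 2).
by rewrite hx [X in _ <= X -> _]ger0_norm; lra.
Qed.

(** The common ray determines, by straightness, a common point q behind p; w is
    the point at time 1 of the ray.  At y, f lies between f p + 1 - d(q, y) and
    f p - 1 + d(w, y), and likewise g with g p in place of f p. *)
Lemma horo_difference f g p (h : rays p) :
  direction f p = inr h -> direction g p = inr h ->
  exists q w, [/\ mdist q p = 1, mdist p w = 1, mdist q w = 2 &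
    forall y, `|(horo f y - horo g y) - (horo f p - horo g p)| <=
      mdist y q + mdist y w - 2].
Proof.
have line_of f' : direction f' p = inr h -> exists2 G : R -> X, line G &
    [/\ {in `[0, +oo[, ray_at h =1 G}, horo f' (G (- 1)) = horo f' p + 1 &
        horo f' (G 1) <= horo f' p - 1].
  move=> f'h; have [z gz] := direction_exists f' p.
  rewrite f'h => /polar_inr [zy zh].
  have [q [qp fq]] := ascent_exists properX straightX geodX x01 p f'.
  have [G lG [Gq /(_ z gz)]] := ascent_gradient_line straightX geodX qp fq.
  rewrite zy zh => /(_ (ltry 0)) hG.
  exists G => //; split => //; first by rewrite Gq.
  rewrite -hG; last by rewrite in_itv /=; lra.
  by have [/(_ 1) + _] := gz; rewrite /= zy zh ltry; exact.
move=> /line_of [G lG [hG fq fw]] /line_of [G' lG' [hG' gq gw]].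
have GG' : G =1 G'.
  apply: (line_unique straightX (a := 0) (b := 1)) => // t tI.
  by rewrite -hG -?hG' //; move: tI; rewrite !in_itv /=; lra.
have Gp : G 0 = p by rewrite -hG ?ray_at0 // in_itv /=; lra.
exists (G (- 1)), (G 1); rewrite -{1 2}Gp !lG.
split; [rewrite ler0_norm; lra|rewrite ler0_norm; lra|rewrite ler0_norm; lra|].
move=> y; rewrite -GG' in gq; rewrite -GG' in gw.
have := horo_lipschitz f y (G 1); have := horo_lipschitz g y (G 1).
have := horo_lipschitz f (G (- 1)) y; have := horo_lipschitz g (G (- 1)) y.
rewrite [mdist (G (- 1)) y]metric_sym ler_norml; lra.
Qed.

(** Along a line the difference has derivative zero at each point, by
    [horo_difference] at that point; the values at the base point agree. *)
Lemma direction_injective f g :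
  (forall p, direction f p = direction g p) -> f = g.
Proof.
move=> fg.
have [[p [x fx]]|/forallNP inr_dir] :=
    pselect (exists p x, direction f p = inl x).
  by rewrite (direction_inl fx) (direction_inl (etrans (esym (fg p)) fx)).
apply: horo_inj => y.
have [G lG [G0 Gy]] := line_to straightX geodX x01 o y.
pose u t := horo f (G t) - horo g (G t).
have du (t : R) : is_derive t (1 : R) u 0.
  have [h fh] : exists h, direction f (G t) = inr h.
    case fE : (direction f (G t)) => [x|h]; last by exists h.
    by case: (inr_dir (G t)); exists x.
  have [q [w [qp pw qw duq]]] := horo_difference fh (etrans (esym (fg _)) fh).
  apply: is_derive_squeeze0 (is_derive_excess C1X lG qp pw qw) _ _.
    by rewrite [mdist _ q]metric_sym qp pw; lra.
  by move=> s; exact: duq.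
have := is_derive_0_is_cst (mdist o y) 0 du.
by rewrite /u Gy G0 !horo_base; lra.
Qed.

End Directions.

(** * The isomorphism *)

Lemma hausdorff_visual_compactification (R : realType) (X : metricType R) :
  (forall p : X, hausdorff_space (visual p)) ->
  hausdorff_space (visual_compactification X).
Proof.
move=> hv; apply: separated_hausdorff => v w vw.
have [p vwp] : exists p, set_val v p <> set_val w p.
  apply: contrapT => /forallNP vwp; apply: vw; apply: val_inj.
  apply: functional_extensionality_dep => p.
  by apply: contrapT; exact: (vwp p).
exists (visual p), (fun v => set_val v p); split => //.
move=> v'; apply: (@continuous_comp _ _ _ set_val
  (fun e : @visual_product R X => e p)); first exact: initial_continuous.
exact: (@proj_continuous X (fun p => visual p) p).
Qed.

Theorem theorem3p12 (R : realType) (X : metricType R) (b : X) :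
  proper_space X ->
  uniquely_geodesic X ->
  straight X ->
  C1_along_geodesics X ->
  constant_distance_variation X ->
  isomorphic_compactifications (visual_embedding X) (horofunction_embedding b).
Proof.
move=> properX geodX straightX C1X _.
suff [hV [g [cg ig gE]]] : hausdorff_space (visual_compactification X) /\
    exists g : horofunction_compactification b -> visual_compactification X,
    [/\ continuous g, injective g
      & g \o horofunction_embedding b = visual_embedding X].
  apply: (isomorphic_compactifications_of_bijection _ hV _ cg ig gE).
    exact: horofunction_is_compactification.
  exact: dense_to_closure.
have [[x1 bx1]|/forallNP X1] := pselect (exists x, b <> x).
  split.
    apply: hausdorff_visual_compactification => p.
    apply: hausdorff_visual => //.
    exact: (@polar_onto _ _ b straightX geodX b x1 bx1).
  pose d (f : horofunction_compactification b) : @visual_product R X :=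
    direction properX straightX geodX bx1 f.
  have cd : continuous d.
    by apply: continuous_into_product => p; exact: continuous_direction.
  have dV f : closure (range visual_diagonal) (d f).
    move: f; apply: horofunction_limit.
      by move: cd => /continuous_closedP /(_ (closure (range visual_diagonal)));
         apply; exact: closed_closure.
    move=> x; apply: subset_closure; exists x => //.
    apply: functional_extensionality_dep => p.
    by rewrite /d direction_embedding.
  exists (fun f => exist _ (d f) (mem_set (dV f))); split.
  - exact: continuous_into_set_type.
  - move=> f f' ff'; apply: (direction_injective (properX := properX)
      (straightX := straightX) (geodX := geodX) C1X (x01 := bx1)) => p.
    exact: (congr1 (fun v : visual_compactification X => set_val v p) ff').
  - apply/funext => x; apply: val_inj.
    by apply: functional_extensionality_dep => p; exact: direction_embedding.
(* X is a single point: there is no ray, and both spaces are single points. *)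
have bX x : b = x by apply: contrapT; exact: X1.
have norays (p : X) (h : rays p) : False.
  have := @mdist_ray_at _ _ _ h 0 1 (lexx 0) ler01.
  rewrite -(bX (ray_at h 0)) -(bX (ray_at h 1)) mdistxx.
  by rewrite sub0r normrN normr1; lra.
split.
  apply: hausdorff_visual_compactification => p.
  apply: separated_hausdorff => -[x|h] [y|h'] //; last 1 first.
  - by case: (norays _ h).
  - by rewrite -(bX x) -(bX y).
  - by case: (norays _ h').
  - by case: (norays _ h).
exists (fun=> visual_embedding X b); split.
- by move=> ?; exact: cst_continuous.
- by move=> f f' _; apply: horo_inj => x; rewrite -(bX x) !horo_base.
- by apply/funext => x; rewrite /= (bX x).
Qed.
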